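(* Let $s\ge 1$, let $a_{ij},b_i\in\mathbb{R}$ ($i,j=1,\dots,s$) be Runge--Kutta coefficients with $c_i=\sum_{j=1}^s a_{ij}$, and suppose that $$b_ia_{ij}+b_ja_{ji}=b_ib_j\qquad\text{for all } i,j=1,\dots,s.$$ Let $(u^n,q^n)$, $n=0,1,2,\dots$, be produced by the following linear scheme (Scheme 2.3) with time step $\tau>0$: for each $n\ge0$, given $(u^n,q^n)$ and the extrapolated values $u_i^{n,*}=\mathcal{L}_{EP}(\mathbf{x},t_n+c_i\tau)$, $i=1,\dots,s$, the stages $u_i^n,q_i^n,k_i^n,l_i^n$ satisfy, for $i=1,\dots,s$, $$k_i^n=\mathcal{S}\Big(u_i^n+\tfrac16q_i^n+\tfrac13u_i^{n,*}u_i^n\Big),\qquad u_i^n=u^n+\tau\sum_{j=1}^s a_{ij}k_j^n,$$ $$q_i^n=q^n+\tau\sum_{j=1}^s a_{ij}l_j^n,\qquad l_i^n=2u_i^{n,*}k_i^n,$$ and $$u^{n+1}=u^n+\tau\sum_{i=1}^s b_ik_i^n,\qquad q^{n+1}=q^n+\tau\sum_{i=1}^s b_il_i^n.$$ Then the scheme preserves the semi-discrete energy: $$E^{n+1}=E^n,\qquad E^n:=\int_\Omega\Big(\tfrac12(u^n)^2+\tfrac16u^nq^n\Big)d\mathbf{x},\qquad n=0,1,2,\dots$$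
   Context: Setting: the regularized long-wave equation $\partial_tu+\alpha\partial_xu+\beta\partial_yu+\alpha u\partial_xu+\beta u\partial_yu-\mu\partial_{xxt}u-\theta\partial_{yyt}u=0$ on $\Omega=[a,b]\times[c,d]$ with periodic boundary conditions, where $\alpha,\beta\in\mathbb{R}$, $\mu>0$, $\theta>0$ are constants. All functions of $\mathbf{x}=(x,y)$ are real-valued, periodic on $\Omega$ and smooth; the scheme is discrete in time only. $\mathcal{S}=-(1-\mu\partial_{xx}-\theta\partial_{yy})^{-1}(\alpha\partial_x+\beta\partial_y)$, acting on periodic functions. With the auxiliary variable $q=u^2$, the equation is reformulated as $\partial_tu=\mathcal{S}(u+\frac16q+\frac13u^2)$, $\partial_tq=2u\,\partial_tu$, of which the scheme is a linearized time discretization. Time grid: $t_n=n\tau$, $t_{ni}=t_n+c_i\tau$, with $c_1,\dots,c_s$ distinct real numbers; $u^n,q^n$ and $u_i^n,q_i^n$ approximate $u,q$ at $t_n$ and $t_{ni}$. At step $n$, $\mathcal{L}_{EP}(\mathbf{x},t)$ is the Lagrange interpolating polynomial in $t$ (with coefficients functions of $\mathbf{x}$) through numerical values of $u$ already computed at finitely many distinct time nodes $\le t_n$ (values $u^m$ at grid points and/or earlier stage values). In particular each $u_i^{n,*}$ is a known function of $\mathbf{x}$, independent of the unknowns of step $n$. *)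

(* Defs.v *)
From Stdlib Require Import Reals List.
From Coquelicot Require Import Coquelicot.
Import ListNotations.
Local Open Scope R_scope.

(* Functions on Omega = [xl,xr] x [yl,yr] with periodic boundary conditions
   are represented by their periodic extensions to the whole plane. *)
Definition field := R -> R -> R.

Definition smooth (f : field) : Prop := forall n x y, ex_diff_n f n x y.

Definition periodic (xl xr yl yr : R) (f : field) : Prop :=
  forall x y, f (x + (xr - xl)) y = f x y /\ f x (y + (yr - yl)) = f x y.

Definition smooth_periodic (xl xr yl yr : R) (f : field) : Prop :=
  smooth f /\ periodic xl xr yl yr f.

Definition dx (f : field) : field := partial_derive 1 0 f.
Definition dy (f : field) : field := partial_derive 0 1 f.
Definition dxx (f : field) : field := partial_derive 2 0 f.
Definition dyy (f : field) : field := partial_derive 0 2 f.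

Definition helmholtz (mu theta : R) (w : field) : field :=
  fun x y => w x y - mu * dxx w x y - theta * dyy w x y.

(* [helmholtz_inv xl xr yl yr mu theta g w] says
   w = (1 - mu dxx - theta dyy)^{-1} g, the inverse being that of the operator
   on smooth periodic functions.  It is given by its graph: an R-valued choice
   function would silently return a default value at any g whose preimage has
   not been shown to exist. *)
Definition helmholtz_inv (xl xr yl yr mu theta : R) (g w : field) : Prop :=
  smooth_periodic xl xr yl yr w /\
  (forall x y, helmholtz mu theta w x y = g x y).

(* The graph k = S(f) of
   S = - (1 - mu dxx - theta dyy)^{-1} (alpha dx + beta dy). *)
Definition opS (xl xr yl yr alpha beta mu theta : R) (f k : field) : Prop :=
  exists w : field,
    helmholtz_inv xl xr yl yr mu theta
      (fun x y => alpha * dx f x y + beta * dy f x y) w /\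
    (forall x y, k x y = - w x y).

(* Stages are numbered 1, ..., s as in the Butcher tableau. *)
Definition stage_sum (s : nat) (f : nat -> R) : R := sum_n_m f 1 s.

(* The Lagrange basis polynomial at [node] for the list of nodes [T]. *)
Definition lagrange_basis (T : list R) (node t : R) : R :=
  fold_right
    (fun r acc => if Req_EM_T r node then acc else (t - r) / (node - r) * acc)
    1 T.

(* The Lagrange interpolating polynomial through the points (node, value). *)
Definition lagrange (pts : list (R * R)) (t : R) : R :=
  fold_right
    (fun p acc => snd p * lagrange_basis (map fst pts) (fst p) t + acc)
    0 pts.

(* A numerical value of u: either the grid value u^m at t_m, or the stage value
   u_i^m at t_{mi} = t_m + c_i tau. *)
Inductive datum : Type :=
  | Grid (m : nat)
  | Stage (m i : nat).

Definition datum_time (c : nat -> R) (tau : R) (d : datum) : R :=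
  match d with
  | Grid m => INR m * tau
  | Stage m i => INR m * tau + c i * tau
  end.

Definition datum_value (u : nat -> field) (ust : nat -> nat -> field)
    (d : datum) : field :=
  match d with
  | Grid m => u m
  | Stage m i => ust m i
  end.

(* d is already computed when step n (from t_n to t_{n+1}) begins. *)
Definition computed_before (s n : nat) (d : datum) : Prop :=
  match d with
  | Grid m => (m <= n)%nat
  | Stage m i => (m < n)%nat /\ (1 <= i <= s)%nat
  end.

Definition valid_stencil (s : nat) (c : nat -> R) (tau : R) (n : nat)
    (l : list datum) : Prop :=
  l <> [] /\
  NoDup (map (datum_time c tau) l) /\
  (forall d, In d l ->
     computed_before s n d /\ datum_time c tau d <= INR n * tau).

(* L_EP(x, t), for the data listed in [l]. *)
Definition L_EP (c : nat -> R) (tau : R) (u : nat -> field)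
    (ust : nat -> nat -> field) (l : list datum) (x y t : R) : R :=
  lagrange
    (map (fun d => (datum_time c tau d, datum_value u ust d x y)) l) t.

(* u_i^{n,*}, where [stencil n] lists the data interpolated at step n. *)
Definition u_star (c : nat -> R) (tau : R) (u : nat -> field)
    (ust : nat -> nat -> field) (stencil : nat -> list datum)
    (n i : nat) : field :=
  fun x y => L_EP c tau u ust (stencil n) x y (INR n * tau + c i * tau).

(* One step n of the linear scheme: [u], [q] are the grid values and
   [ust], [qst], [k], [l] the stage values u_i^n, q_i^n, k_i^n, l_i^n,
   with the step as first index and the stage as second. *)
Definition scheme_step (xl xr yl yr alpha beta mu theta tau : R) (s : nat)
    (A : nat -> nat -> R) (b c : nat -> R) (stencil : nat -> list datum)
    (u q : nat -> field) (ust qst k l : nat -> nat -> field) (n : nat) : Prop :=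
  let us := u_star c tau u ust stencil n in
  (forall i, (1 <= i <= s)%nat ->
     opS xl xr yl yr alpha beta mu theta
       (fun x y => ust n i x y + 1 / 6 * qst n i x y
                   + 1 / 3 * us i x y * ust n i x y)
       (k n i)) /\
  (forall i, (1 <= i <= s)%nat -> forall x y,
     ust n i x y
     = u n x y + tau * stage_sum s (fun j => A i j * k n j x y)) /\
  (forall i, (1 <= i <= s)%nat -> forall x y,
     qst n i x y
     = q n x y + tau * stage_sum s (fun j => A i j * l n j x y)) /\
  (forall i, (1 <= i <= s)%nat -> forall x y,
     l n i x y = 2 * us i x y * k n i x y) /\
  (forall x y,
     u (n + 1)%nat x y
     = u n x y + tau * stage_sum s (fun i => b i * k n i x y)) /\
  (forall x y,
     q (n + 1)%nat x y
     = q n x y + tau * stage_sum s (fun i => b i * l n i x y)).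

Definition energy (xl xr yl yr : R) (u q : field) : R :=
  RInt (fun x =>
    RInt (fun y => 1 / 2 * (u x y) ^ 2 + 1 / 6 * u x y * q x y) yl yr) xl xr.

(* Main.v *)
Require Import Defs.
From Stdlib Require Import Reals List Lia Lra FunctionalExtensionality.
From Coquelicot Require Import Coquelicot.
Local Open Scope R_scope.

(** The proof has two independent halves.

    Algebra.  Under the symplectic condition, a product of two quantities that
    both evolve by the same Runge--Kutta update obeys an exact discrete Leibniz
    rule ([symplectic_sum_product]).  The energy density u^2/2 + uq/6 is
    quadratic in (u, q), so its increment over one step is, pointwise,
      tau * sum_i b_i (k_i u_i + (k_i q_i + l_i u_i) / 6),
    and l_i = 2 u_i^* k_i turns the i-th term into k_i f_i, where f_i is the
    argument of S in the i-th stage ([symplectic_energy_increment]).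
    It remains to see that the integral of f S(f) vanishes.

    Analysis.  Write H = 1 - mu dxx - theta dyy, D = alpha dx + beta dy and
    k = S(f), so that H k = - D f.  Formally S is skew because H is symmetric
    and commutes with the skew operator D; to say so directly one would apply
    the inverse of H to f, which needs a solution of H g = f.  Instead one
    solves along the characteristics of D, where the solution is an explicit
    integral.  Suppose (lambda - D) F = f and (lambda - D) g = k for some
    lambda > 0.  As H commutes with lambda - D, also H g = - D F, and
      <f, k> = <lambda F - D F, lambda g - D g> = lambda^2 <F, g>:
    the two mixed terms cancel because D is skew, and <D F, D g> =
    - <H g, D g> = 0.  Moreover |f|^2 = lambda^2 |F|^2 + |D F|^2, and
    |g|^2 <= <H g, g> = - <D F, g> gives |g| <= |D F| <= |f|.  Hence
    |<f, k>| <= lambda |f|^2 for every lambda > 0, and <f, k> = 0.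

    The exact F is the Laplace transform of f along the flow of D.  Cutting
    that integral at a finite time T ([char_int]) avoids improper integrals and
    only replaces f and k by f - e f_T and k - e k_T, where f_T is the
    translate of f by T (alpha, beta) and e = exp (- lambda T).  Translation
    preserves the integral over a period cell, so these perturbations are of
    size e, and e tends to 0 along with lambda when T grows fast enough
    ([ip_damped_bound], [ip_flow_orthogonal]). *)

(** * Calculus of smooth fields *)

Definition lin (a : R) (f : field) (b : R) (g : field) : field :=
  fun x y => a * f x y + b * g x y.

Definition mul (f g : field) : field := fun x y => f x y * g x y.

Lemma field_ext (f g : field) : (forall x y, f x y = g x y) -> f = g.
Proof.
  intros H. apply functional_extensionality. intros x.
  apply functional_extensionality. intros y. apply H.
Qed.

Lemma smooth_continuous_2d f : smooth f -> forall x y, continuity_2d_pt f x y.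
Proof. intros H x y. exact (proj1 (H 0%nat x y)). Qed.

Lemma smooth_ex_derive_x f : smooth f ->
  forall x y, ex_derive (fun z => f z y) x.
Proof. intros H x y. exact (proj1 (proj2 (H 1%nat x y))). Qed.

Lemma smooth_ex_derive_y f : smooth f ->
  forall x y, ex_derive (fun z => f x z) y.
Proof. intros H x y. exact (proj1 (proj2 (proj2 (H 1%nat x y)))). Qed.

Lemma smooth_dx f : smooth f -> smooth (dx f).
Proof.
  intros H n x y.
  exact (proj1 (proj2 (proj2 (proj2 (H (S n) x y))))).
Qed.

Lemma smooth_dy f : smooth f -> smooth (dy f).
Proof.
  intros H n x y.
  exact (proj2 (proj2 (proj2 (proj2 (H (S n) x y))))).
Qed.

Lemma is_derive_dx f : smooth f ->
  forall x y, is_derive (fun z => f z y) x (dx f x y).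
Proof. intros H x y. apply Derive_correct, smooth_ex_derive_x, H. Qed.

Lemma is_derive_dy f : smooth f ->
  forall x y, is_derive (fun z => f x z) y (dy f x y).
Proof. intros H x y. apply Derive_correct, smooth_ex_derive_y, H. Qed.

Lemma dx_unique f g : (forall x y, is_derive (fun z => f z y) x (g x y)) ->
  dx f = g.
Proof. intros H. apply field_ext. intros x y. apply is_derive_unique, H. Qed.

Lemma dy_unique f g : (forall x y, is_derive (fun z => f x z) y (g x y)) ->
  dy f = g.
Proof. intros H. apply field_ext. intros x y. apply is_derive_unique, H. Qed.

(** Smoothness is coinductive in nature: it is enough to find a class of
    continuous fields that have both first partial derivatives and is stable
    under taking them. *)
Lemma smooth_of_stable_class (P : field -> Prop) :
  (forall f, P f -> forall x y, continuity_2d_pt f x y) ->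
  (forall f, P f -> exists g, P g /\
     forall x y, is_derive (fun z => f z y) x (g x y)) ->
  (forall f, P f -> exists g, P g /\
     forall x y, is_derive (fun z => f x z) y (g x y)) ->
  forall f, P f -> smooth f.
Proof.
  intros Hc Hx Hy f Hf n. revert f Hf.
  induction n as [|n IH]; intros f Hf x y; split; try (apply Hc, Hf).
  - exact I.
  - destruct (Hx f Hf) as [gx [Pgx Hgx]], (Hy f Hf) as [gy [Pgy Hgy]].
    split; [eexists; apply Hgx|]. split; [eexists; apply Hgy|].
    change (ex_diff_n (dx f) n x y /\ ex_diff_n (dy f) n x y).
    rewrite (dx_unique f gx Hgx), (dy_unique f gy Hgy). auto.
Qed.

Lemma is_derive_lin (a b : R) (f g : R -> R) (x df dg : R) :
  is_derive f x df -> is_derive g x dg ->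
  is_derive (fun z => a * f z + b * g z) x (a * df + b * dg).
Proof.
  intros Hf Hg.
  apply (is_derive_plus (fun z => a * f z) (fun z => b * g z)).
  - now apply (is_derive_scal f).
  - now apply (is_derive_scal g).
Qed.

Lemma is_derive_mul (f g : R -> R) (x df dg : R) :
  is_derive f x df -> is_derive g x dg ->
  is_derive (fun z => f z * g z) x (1 * (df * g x) + 1 * (f x * dg)).
Proof.
  intros Hf Hg. rewrite !Rmult_1_l.
  apply (is_derive_mult f g x df dg); auto. intros; apply Rmult_comm.
Qed.

(** The algebra generated by the smooth fields; it is stable under both partial
    derivatives, hence consists of smooth fields. *)
Inductive smooth_algebra : field -> Prop :=
  | alg_base f : smooth f -> smooth_algebra f
  | alg_lin a f b g :
      smooth_algebra f -> smooth_algebra g -> smooth_algebra (lin a f b g)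
  | alg_mul f g :
      smooth_algebra f -> smooth_algebra g -> smooth_algebra (mul f g).

Lemma smooth_algebra_smooth f : smooth_algebra f -> smooth f.
Proof.
  revert f. apply smooth_of_stable_class; induction 1 as
    [f Hf|a f b g Hf IHf Hg IHg|f g Hf IHf Hg IHg].
  - intros x y. now apply smooth_continuous_2d.
  - intros x y. apply continuity_2d_pt_plus; apply continuity_2d_pt_mult;
      auto using continuity_2d_pt_const.
  - intros x y. apply continuity_2d_pt_mult; auto.
  - exists (dx f). split; [apply alg_base, smooth_dx, Hf|].
    now apply is_derive_dx.
  - destruct IHf as [f' [Pf Df]], IHg as [g' [Pg Dg]].
    exists (lin a f' b g'). split; [now apply alg_lin|].
    intros x y. now apply is_derive_lin.
  - destruct IHf as [f' [Pf Df]], IHg as [g' [Pg Dg]].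
    exists (lin 1 (mul f' g) 1 (mul f g')).
    split; [now apply alg_lin; apply alg_mul|].
    intros x y. now apply (is_derive_mul (fun z => f z y) (fun z => g z y)).
  - exists (dy f). split; [apply alg_base, smooth_dy, Hf|].
    now apply is_derive_dy.
  - destruct IHf as [f' [Pf Df]], IHg as [g' [Pg Dg]].
    exists (lin a f' b g'). split; [now apply alg_lin|].
    intros x y. now apply (is_derive_lin a b (f x) (g x)).
  - destruct IHf as [f' [Pf Df]], IHg as [g' [Pg Dg]].
    exists (lin 1 (mul f' g) 1 (mul f g')).
    split; [now apply alg_lin; apply alg_mul|].
    intros x y. now apply (is_derive_mul (f x) (g x)).
Qed.

Lemma smooth_lin a f b g : smooth f -> smooth g -> smooth (lin a f b g).
Proof. intros. apply smooth_algebra_smooth, alg_lin; now apply alg_base. Qed.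

Lemma smooth_mul f g : smooth f -> smooth g -> smooth (mul f g).
Proof. intros. apply smooth_algebra_smooth, alg_mul; now apply alg_base. Qed.

Lemma smooth_const c : smooth (fun _ _ => c).
Proof.
  apply (smooth_of_stable_class (fun f => exists c, f = fun _ _ => c)).
  - intros f [c' ->] x y. apply continuity_2d_pt_const.
  - intros f [c' ->]. exists (fun _ _ => 0). split; [now exists 0|].
    intros x y. apply (is_derive_const (V := R_NormedModule) c').
  - intros f [c' ->]. exists (fun _ _ => 0). split; [now exists 0|].
    intros x y. apply (is_derive_const (V := R_NormedModule) c').
  - now exists c.
Qed.

Lemma dx_lin a f b g : smooth f -> smooth g ->
  dx (lin a f b g) = lin a (dx f) b (dx g).
Proof.
  intros Hf Hg. apply dx_unique. intros x y.
  apply is_derive_lin; now apply is_derive_dx.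
Qed.

Lemma dy_lin a f b g : smooth f -> smooth g ->
  dy (lin a f b g) = lin a (dy f) b (dy g).
Proof.
  intros Hf Hg. apply dy_unique. intros x y.
  apply (is_derive_lin a b (f x) (g x)); now apply is_derive_dy.
Qed.

Lemma dx_mul f g : smooth f -> smooth g ->
  dx (mul f g) = lin 1 (mul (dx f) g) 1 (mul f (dx g)).
Proof.
  intros Hf Hg. apply dx_unique. intros x y.
  apply (is_derive_mul (fun z => f z y) (fun z => g z y)); now apply is_derive_dx.
Qed.

Lemma dy_mul f g : smooth f -> smooth g ->
  dy (mul f g) = lin 1 (mul (dy f) g) 1 (mul f (dy g)).
Proof.
  intros Hf Hg. apply dy_unique. intros x y.
  apply (is_derive_mul (f x) (g x)); now apply is_derive_dy.
Qed.

Lemma dx_dy_comm f : smooth f -> dx (dy f) = dy (dx f).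
Proof.
  intros Hf. apply field_ext. intros x y.
  apply (Schwarz f x y).
  - apply locally_2d_forall. intros u v. repeat split.
    + now apply smooth_ex_derive_x.
    + now apply smooth_ex_derive_y.
    + now apply (smooth_ex_derive_x (dy f)), smooth_dy.
    + now apply (smooth_ex_derive_y (dx f)), smooth_dx.
  - now apply (smooth_continuous_2d (dx (dy f))), smooth_dx, smooth_dy.
  - now apply (smooth_continuous_2d (dy (dx f))), smooth_dy, smooth_dx.
Qed.

(** * Periodic fields and their integral over a period cell *)

Lemma smooth_periodic_lin xl xr yl yr a f b g :
  smooth_periodic xl xr yl yr f -> smooth_periodic xl xr yl yr g ->
  smooth_periodic xl xr yl yr (lin a f b g).
Proof.
  intros [Sf Pf] [Sg Pg]. split; [now apply smooth_lin|].
  intros x y. unfold lin. destruct (Pf x y) as [-> ->], (Pg x y) as [-> ->].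
  auto.
Qed.

Lemma smooth_periodic_mul xl xr yl yr f g :
  smooth_periodic xl xr yl yr f -> smooth_periodic xl xr yl yr g ->
  smooth_periodic xl xr yl yr (mul f g).
Proof.
  intros [Sf Pf] [Sg Pg]. split; [now apply smooth_mul|].
  intros x y. unfold mul. destruct (Pf x y) as [-> ->], (Pg x y) as [-> ->].
  auto.
Qed.

Lemma Derive_shift (f : R -> R) (a x : R) :
  Derive f (x + a) = Derive (fun z => f (z + a)) x.
Proof.
  unfold Derive. f_equal. apply Lim_ext. intros h.
  now replace (x + h + a) with (x + a + h) by ring.
Qed.

Lemma smooth_periodic_dx xl xr yl yr f :
  smooth_periodic xl xr yl yr f -> smooth_periodic xl xr yl yr (dx f).
Proof.
  intros [Sf Pf]. split; [now apply smooth_dx|]. intros x y. split.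
  - transitivity (Derive (fun z => f (z + (xr - xl)) y) x).
    + apply (Derive_shift (fun z => f z y)).
    + apply Derive_ext. intros z. apply Pf.
  - apply Derive_ext. intros z. apply Pf.
Qed.

Lemma smooth_periodic_dy xl xr yl yr f :
  smooth_periodic xl xr yl yr f -> smooth_periodic xl xr yl yr (dy f).
Proof.
  intros [Sf Pf]. split; [now apply smooth_dy|]. intros x y. split.
  - apply Derive_ext. intros z. apply Pf.
  - transitivity (Derive (fun z => f x (z + (yr - yl))) y).
    + apply (Derive_shift (fun z => f x z)).
    + apply Derive_ext. intros z. apply Pf.
Qed.
Lemma smooth_continuous_y f : smooth f -> forall x y, continuous (f x) y.
Proof.
  intros H x y. apply (ex_derive_continuous (f x)), smooth_ex_derive_y, H.
Qed.

Lemma ex_RInt_smooth_y f : smooth f -> forall x a b, ex_RInt (f x) a b.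
Proof.
  intros H x a b. apply (ex_RInt_continuous (V := R_CompleteNormedModule)).
  intros z _. now apply smooth_continuous_y.
Qed.

Lemma is_derive_RInt_smooth f : smooth f -> forall x a b,
  is_derive (fun z => RInt (f z) a b) x (RInt (dx f x) a b).
Proof.
  intros H x a b. apply (is_derive_RInt_param f).
  - apply filter_forall. intros z t _. now apply smooth_ex_derive_x.
  - intros t _. now apply (smooth_continuous_2d (dx f)), smooth_dx.
  - apply filter_forall. intros z. now apply ex_RInt_smooth_y.
Qed.

Lemma continuous_RInt_smooth f : smooth f -> forall x a b,
  continuous (fun z => RInt (f z) a b) x.
Proof.
  intros H x a b. apply (ex_derive_continuous (fun z => RInt (f z) a b)).
  eexists. now apply is_derive_RInt_smooth.
Qed.

Lemma ex_RInt_RInt_smooth f : smooth f -> forall a b c d,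
  ex_RInt (fun x => RInt (f x) a b) c d.
Proof.
  intros H a b c d. apply (ex_RInt_continuous (V := R_CompleteNormedModule)).
  intros z _. now apply continuous_RInt_smooth.
Qed.

Lemma RInt_lin (f g : R -> R) a b l r : ex_RInt f l r -> ex_RInt g l r ->
  RInt (fun t => a * f t + b * g t) l r = a * RInt f l r + b * RInt g l r.
Proof.
  intros Hf Hg.
  rewrite (RInt_plus (V := R_CompleteNormedModule)
             (fun t => a * f t) (fun t => b * g t)).
  - apply (f_equal2 Rplus).
    + now apply (RInt_scal (V := R_CompleteNormedModule) f).
    + now apply (RInt_scal (V := R_CompleteNormedModule) g).
  - now apply (ex_RInt_scal (V := R_NormedModule) f).
  - now apply (ex_RInt_scal (V := R_NormedModule) g).
Qed.

Lemma RInt_translate (f : R -> R) a l r : (forall x, continuous f x) ->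
  RInt (fun t => f (t + a)) l r = RInt f (l + a) (r + a).
Proof.
  intros Hf.
  rewrite <- (Rmult_1_l l) at 2. rewrite <- (Rmult_1_l r) at 2.
  rewrite <- (RInt_comp_lin (V := R_CompleteNormedModule) f).
  - apply RInt_ext. intros t _. cbv [scal]; simpl; cbv [mult]; simpl.
    now rewrite !Rmult_1_l.
  - apply (ex_RInt_continuous (V := R_CompleteNormedModule)). intros; apply Hf.
Qed.

(** Translating the window changes the integral by the integrals over [l, l + a]
    and [r, r + a], which agree by periodicity. *)
Lemma RInt_translate_periodic (f : R -> R) a l r :
  (forall x, continuous f x) -> (forall x, f (x + (r - l)) = f x) ->
  RInt (fun t => f (t + a)) l r = RInt f l r.
Proof.
  intros Hf Hp. rewrite RInt_translate by exact Hf.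
  assert (Hex : forall c d, ex_RInt f c d).
  { intros c d. apply (ex_RInt_continuous (V := R_CompleteNormedModule)).
    intros; apply Hf. }
  assert (Hend : RInt f r (r + a) = RInt f l (l + a)).
  { transitivity (RInt (fun t => f (t + (r - l))) l (l + a)).
    - rewrite RInt_translate by exact Hf. f_equal; ring.
    - apply RInt_ext. intros t _. apply Hp. }
  pose proof (RInt_Chasles (V := R_CompleteNormedModule) f l (l + a) (r + a)
    (Hex _ _) (Hex _ _)) as E1.
  pose proof (RInt_Chasles (V := R_CompleteNormedModule) f l r (r + a)
    (Hex _ _) (Hex _ _)) as E2.
  cbv [plus] in E1, E2; simpl in E1, E2. lra.
Qed.

Section PeriodCell.

Variables xl xr yl yr : R.
Hypotheses (hx : xl < xr) (hy : yl < yr).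

Local Notation SP := (smooth_periodic xl xr yl yr).

Definition iint (f : field) : R := RInt (fun x => RInt (f x) yl yr) xl xr.

Definition ip (f g : field) : R := iint (mul f g).

Lemma iint_ext f g : (forall x y, f x y = g x y) -> iint f = iint g.
Proof. intros H. now rewrite (field_ext f g H). Qed.

Lemma iint_lin a f b g : smooth f -> smooth g ->
  iint (lin a f b g) = a * iint f + b * iint g.
Proof.
  intros Hf Hg. unfold iint.
  rewrite <- RInt_lin by now apply ex_RInt_RInt_smooth.
  apply RInt_ext. intros x _.
  now apply RInt_lin; apply ex_RInt_smooth_y.
Qed.

Lemma iint_zero : iint (fun _ _ => 0) = 0.
Proof.
  rewrite (iint_ext _ (lin 0 (fun _ _ => 0) 0 (fun _ _ => 0))).
  - rewrite iint_lin by apply smooth_const. ring.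
  - intros x y. unfold lin. ring.
Qed.

Lemma iint_nonneg f : smooth f -> (forall x y, 0 <= f x y) -> 0 <= iint f.
Proof.
  intros Hf Hp. apply RInt_ge_0; [lra|now apply ex_RInt_RInt_smooth|].
  intros x _. apply RInt_ge_0; [lra|now apply ex_RInt_smooth_y|].
  intros y _. apply Hp.
Qed.

(** The x-derivative is taken under the inner integral, so that the outer one
    is the integral of a derivative. *)
Lemma iint_dx f : SP f -> iint (dx f) = 0.
Proof.
  intros [Sf Pf]. unfold iint.
  transitivity (RInt (Derive (fun x => RInt (f x) yl yr)) xl xr).
  - apply RInt_ext. intros x _. symmetry.
    now apply is_derive_unique, is_derive_RInt_smooth.
  - rewrite RInt_Derive.
    (* Periodicity: both end points give the same inner integral. *)
    + replace xr with (xl + (xr - xl)) at 1 by ring.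
      rewrite (RInt_ext (f (xl + (xr - xl))) (f xl)); [ring|].
      intros y _. apply Pf.
    + intros x _. eexists. now apply is_derive_RInt_smooth.
    + intros x _.
      apply (continuous_ext (fun z => RInt (dx f z) yl yr)).
      * intros z. symmetry. now apply is_derive_unique, is_derive_RInt_smooth.
      * now apply continuous_RInt_smooth, smooth_dx.
Qed.

Lemma iint_dy f : SP f -> iint (dy f) = 0.
Proof.
  intros [Sf Pf]. rewrite <- iint_zero. unfold iint.
  apply RInt_ext. intros x _.
  transitivity (RInt (Derive (f x)) yl yr); [reflexivity|].
  rewrite RInt_Derive.
  - rewrite RInt_const. replace yr with (yl + (yr - yl)) at 1 by ring.
    rewrite (proj2 (Pf x yl)).
    cbv [scal]; simpl; cbv [mult]; simpl. ring.
  - intros y _. now apply smooth_ex_derive_y.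
  - intros y _. now apply (smooth_continuous_y (dy f)), smooth_dy.
Qed.

Definition translate (a b : R) (f : field) : field :=
  fun x y => f (x + a) (y + b).

Lemma iint_translate a b f : SP f -> iint (translate a b f) = iint f.
Proof.
  intros [Sf Pf]. unfold iint, translate.
  transitivity (RInt (fun x => RInt (f (x + a)) yl yr) xl xr).
  - apply RInt_ext. intros x _. apply RInt_translate_periodic.
    + intros y. now apply smooth_continuous_y.
    + intros y. apply Pf.
  - apply (RInt_translate_periodic (fun x => RInt (f x) yl yr)).
    + intros x. now apply continuous_RInt_smooth.
    + intros x. apply RInt_ext. intros y _. apply Pf.
Qed.

Lemma ip_comm f g : ip f g = ip g f.
Proof. apply iint_ext. intros x y. apply Rmult_comm. Qed.

Lemma ip_lin_l a f b g h : smooth f -> smooth g -> smooth h ->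
  ip (lin a f b g) h = a * ip f h + b * ip g h.
Proof.
  intros Hf Hg Hh. unfold ip.
  rewrite <- iint_lin by now apply smooth_mul.
  apply iint_ext. intros x y. unfold mul, lin. ring.
Qed.

Lemma ip_lin_r a f b g h : smooth f -> smooth g -> smooth h ->
  ip h (lin a f b g) = a * ip h f + b * ip h g.
Proof.
  intros Hf Hg Hh. rewrite (ip_comm h), (ip_comm h f), (ip_comm h g).
  now apply ip_lin_l.
Qed.

Lemma ip_nonneg f : smooth f -> 0 <= ip f f.
Proof.
  intros Hf. apply iint_nonneg; [now apply smooth_mul|].
  intros x y. unfold mul. nra.
Qed.

(** Integration by parts; periodicity cancels the boundary terms. *)
Lemma ip_dx f g : SP f -> SP g -> ip (dx f) g = - ip f (dx g).
Proof.
  intros Hf Hg.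
  pose proof (iint_dx (mul f g) (smooth_periodic_mul _ _ _ _ _ _ Hf Hg)) as E.
  destruct Hf as [Sf _], Hg as [Sg _].
  rewrite dx_mul in E by assumption.
  rewrite iint_lin in E by auto using smooth_mul, smooth_dx.
  unfold ip. lra.
Qed.

Lemma ip_dy f g : SP f -> SP g -> ip (dy f) g = - ip f (dy g).
Proof.
  intros Hf Hg.
  pose proof (iint_dy (mul f g) (smooth_periodic_mul _ _ _ _ _ _ Hf Hg)) as E.
  destruct Hf as [Sf _], Hg as [Sg _].
  rewrite dy_mul in E by assumption.
  rewrite iint_lin in E by auto using smooth_mul, smooth_dy.
  unfold ip. lra.
Qed.

Lemma ip_dx_self f : SP f -> ip (dx f) f = 0.
Proof. intros H. pose proof (ip_dx f f H H). rewrite (ip_comm f) in *. lra. Qed.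

Lemma ip_dy_self f : SP f -> ip (dy f) f = 0.
Proof. intros H. pose proof (ip_dy f f H H). rewrite (ip_comm f) in *. lra. Qed.

Lemma ip_translate a b f g : SP f -> SP g ->
  ip (translate a b f) (translate a b g) = ip f g.
Proof.
  intros Hf Hg. apply (iint_translate a b (mul f g)).
  now apply smooth_periodic_mul.
Qed.

(** Cauchy--Schwarz in additive form: it follows from the positivity of the
    square norms of f + g and f - g, and suffices because only orders of
    magnitude matter. *)
Lemma ip_young f g : smooth f -> smooth g ->
  Rabs (ip f g) <= (ip f f + ip g g) / 2.
Proof.
  intros Hf Hg.
  pose proof (ip_nonneg (lin 1 f 1 g) (smooth_lin _ _ _ _ Hf Hg)) as E1.
  pose proof (ip_nonneg (lin 1 f (-1) g) (smooth_lin _ _ _ _ Hf Hg)) as E2.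
  rewrite ip_lin_l, !ip_lin_r in E1, E2 by auto using smooth_lin.
  rewrite (ip_comm g f) in E1, E2.
  apply Rabs_le. lra.
Qed.

(** * The advection and Helmholtz operators *)

Definition advection (alpha beta : R) (f : field) : field :=
  lin alpha (dx f) beta (dy f).

Lemma smooth_periodic_advection alpha beta f :
  SP f -> SP (advection alpha beta f).
Proof.
  intros H. apply smooth_periodic_lin;
    [now apply smooth_periodic_dx|now apply smooth_periodic_dy].
Qed.

Lemma helmholtz_lin mu theta w : helmholtz mu theta w =
  lin 1 (lin 1 w (- mu) (dx (dx w))) (- theta) (dy (dy w)).
Proof.
  apply field_ext. intros x y.
  change (w x y - mu * dx (dx w) x y - theta * dy (dy w) x y =
    1 * (1 * w x y + - mu * dx (dx w) x y) + - theta * dy (dy w) x y).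
  ring.
Qed.

Lemma ip_advection alpha beta f g : SP f -> SP g ->
  ip (advection alpha beta f) g = - ip f (advection alpha beta g).
Proof.
  intros Hf Hg. pose proof (proj1 Hf). pose proof (proj1 Hg).
  unfold advection.
  rewrite ip_lin_l, ip_lin_r, ip_dx, ip_dy by auto using smooth_dx, smooth_dy.
  ring.
Qed.

Lemma ip_advection_self alpha beta f : SP f ->
  ip (advection alpha beta f) f = 0.
Proof.
  intros Hf. pose proof (ip_advection alpha beta f f Hf Hf) as E.
  rewrite (ip_comm f) in E. lra.
Qed.

(** Integrating by parts, <H g, g> = |g|^2 + mu |dx g|^2 + theta |dy g|^2. *)
Lemma ip_helmholtz_coercive mu theta g : 0 <= mu -> 0 <= theta -> SP g ->
  ip g g <= ip (helmholtz mu theta g) g.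
Proof.
  intros Hmu Htheta Hg.
  pose proof (smooth_periodic_dx _ _ _ _ _ Hg) as Hgx.
  pose proof (smooth_periodic_dy _ _ _ _ _ Hg) as Hgy.
  pose proof (proj1 Hg). pose proof (proj1 Hgx). pose proof (proj1 Hgy).
  rewrite helmholtz_lin.
  rewrite !ip_lin_l by auto using smooth_lin, smooth_dx, smooth_dy.
  rewrite (ip_dx (dx g)), (ip_dy (dy g)) by assumption.
  pose proof (ip_nonneg (dx g)). pose proof (ip_nonneg (dy g)).
  assert (0 <= mu * ip (dx g) (dx g)) by (apply Rmult_le_pos; auto).
  assert (0 <= theta * ip (dy g) (dy g)) by (apply Rmult_le_pos; auto).
  lra.
Qed.

(** H is symmetric and commutes with the skew operator D, so H D is skew.  Here
    each of the six terms vanishes by itself: it is of the form <dx h, h> or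
    <dy h, h>, with h one of g, dx g, dy g, after at most one integration by
    parts and one exchange of dx and dy. *)
Lemma ip_helmholtz_advection_self mu theta alpha beta g : SP g ->
  ip (helmholtz mu theta g) (advection alpha beta g) = 0.
Proof.
  intros Hg.
  pose proof (smooth_periodic_dx _ _ _ _ _ Hg) as Hgx.
  pose proof (smooth_periodic_dy _ _ _ _ _ Hg) as Hgy.
  pose proof (proj1 Hg). pose proof (proj1 Hgx). pose proof (proj1 Hgy).
  unfold advection. rewrite helmholtz_lin.
  rewrite !ip_lin_l, !ip_lin_r by auto using smooth_lin, smooth_dx, smooth_dy.
  rewrite (ip_dx_self (dx g)), (ip_dy_self (dy g)) by assumption.
  rewrite (ip_dx (dx g) (dy g)), (ip_dy (dy g) (dx g)) by assumption.
  rewrite <- (dx_dy_comm g) by assumption.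
  rewrite (ip_comm (dy g)), ip_dx_self by assumption.
  rewrite (dx_dy_comm g), (ip_comm (dx g) (dy (dx g))), ip_dy_self by assumption.
  rewrite (ip_comm g (dx g)), (ip_comm g (dy g)), ip_dx_self, ip_dy_self
    by assumption.
  ring.
Qed.

End PeriodCell.

Lemma continuity_2d_pt_comp_2 (f g h : field) x y :
  continuity_2d_pt f (g x y) (h x y) ->
  continuity_2d_pt g x y -> continuity_2d_pt h x y ->
  continuity_2d_pt (fun u v => f (g u v) (h u v)) x y.
Proof.
  rewrite !continuity_2d_pt_filterlim. intros Hf Hg Hh.
  exact (continuous_comp_2 (fun z : R * R => g (fst z) (snd z))
    (fun z : R * R => h (fst z) (snd z)) f (x, y) Hg Hh Hf).
Qed.

Lemma is_derive_along_line (alpha beta : R) f : smooth f -> forall x y t,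
  is_derive (fun t => f (x + alpha * t) (y + beta * t)) t
    (advection alpha beta f (x + alpha * t) (y + beta * t)).
Proof.
  intros Hf x y t.
  assert (Hline : forall c d, derivable_pt_lim (fun t => c + d * t) t d).
  { intros c d. apply is_derive_Reals. auto_derive; [exact I|ring]. }
  apply is_derive_Reals. unfold advection, lin.
  rewrite (Rmult_comm alpha (dx f _ _)), (Rmult_comm beta (dy f _ _)).
  apply (derivable_pt_lim_comp_2d f (fun t => x + alpha * t)
    (fun t => y + beta * t)); auto.
  apply filterdiff_differentiable_pt_lim.
  apply (is_derive_filterdiff f _ _ (dx f)).
  - apply filter_forall. intros z. now apply is_derive_dx.
  - now apply is_derive_dy.
  - apply (continuity_2d_pt_filterlim (dx f)).
    now apply smooth_continuous_2d, smooth_dx.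
Qed.

(** * The truncated resolvent of the advection operator *)

Section CharacteristicIntegral.

Variables alpha beta lambda T : R.
Hypotheses (hlambda : 0 <= lambda) (hT : 0 <= T).

Local Notation weighted f x y :=
  (fun t : R => exp (- (lambda * t)) * f (x + alpha * t) (y + beta * t)).

(** The Laplace transform of f along the flow of D, cut at time T.  With
    T infinite this is the resolvent (lambda - D)^-1 f. *)
Definition char_int (f : field) : field :=
  fun x y => RInt (weighted f x y) 0 T.

Lemma is_derive_weighted f : smooth f -> forall x y t,
  is_derive (weighted f x y) t
    (- exp (- (lambda * t)) *
     lin lambda f (-1) (advection alpha beta f) (x + alpha * t) (y + beta * t)).
Proof.
  intros Hf x y t.
  evar_last.
  - apply (is_derive_mult (fun t => exp (- (lambda * t)))
      (fun t => f (x + alpha * t) (y + beta * t))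
      t (- lambda * exp (- (lambda * t)))).
    + auto_derive; [exact I|ring].
    + now apply is_derive_along_line.
    + intros; apply Rmult_comm.
  - cbv [plus mult]; simpl. unfold lin. ring.
Qed.

Lemma ex_RInt_weighted f : smooth f -> forall x y, ex_RInt (weighted f x y) 0 T.
Proof.
  intros Hf x y. apply (ex_RInt_continuous (V := R_CompleteNormedModule)).
  intros t _. apply (ex_derive_continuous (weighted f x y)).
  eexists. now apply is_derive_weighted.
Qed.

Lemma exp_weight_bounds t : 0 <= t -> 0 < exp (- (lambda * t)) <= 1.
Proof.
  intros Ht. split; [apply exp_pos|]. rewrite <- exp_0.
  assert (0 <= lambda * t) by now apply Rmult_le_pos.
  destruct (Req_dec (lambda * t) 0) as [->|]; [rewrite Ropp_0; lra|].
  left. apply exp_increasing. lra.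
Qed.

(** For t in [0, T] the point (x, y) + t (alpha, beta) stays in a fixed compact
    box, on which f is uniformly continuous. *)
Lemma continuity_2d_char_int f : smooth f ->
  forall x y, continuity_2d_pt (char_int f) x y.
Proof.
  intros Hf x y eps.
  assert (Heps : 0 < eps / (T + 1)).
  { apply Rdiv_lt_0_compat; [apply cond_pos|lra]. }
  (* Dividing by T + 1 rather than T covers T = 0; the margin 1 leaves room for
     the perturbed base point (u, v). *)
  set (rx := 1 + Rabs alpha * T). set (ry := 1 + Rabs beta * T).
  destruct (uniform_continuity_2d f (x - rx) (x + rx) (y - ry) (y + ry)
    (fun u v _ _ => smooth_continuous_2d f Hf u v) (mkposreal _ Heps))
    as [d Hd].
  assert (Hmin : 0 < Rmin d 1) by (apply Rmin_pos; [apply cond_pos|lra]).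
  exists (mkposreal _ Hmin). simpl. intros u v Hu Hv.
  assert (Hline : forall c t, 0 <= t <= T ->
    - (Rabs c * T) <= c * t <= Rabs c * T).
  { intros c t Ht. apply Rabs_le_between. rewrite Rabs_mult, (Rabs_pos_eq t) by lra.
    apply Rmult_le_compat_l; [apply Rabs_pos|lra]. }
  assert (Hm1 := Rmin_l d 1). assert (Hm2 := Rmin_r d 1).
  assert (Hu' : -1 < u - x < 1) by (apply Rabs_lt_between; lra).
  assert (Hv' : -1 < v - y < 1) by (apply Rabs_lt_between; lra).
  assert (Ediff : char_int f u v - char_int f x y =
    RInt (fun t => 1 * weighted f u v t + -1 * weighted f x y t) 0 T).
  { rewrite (RInt_lin (weighted f u v) (weighted f x y))
      by now apply ex_RInt_weighted.
    unfold char_int. ring. }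
  rewrite Ediff.
  apply Rle_lt_trans with ((T - 0) * (eps / (T + 1))).
  - apply abs_RInt_le_const; [exact hT| |].
    + apply (ex_RInt_plus (V := R_NormedModule)
        (fun t => 1 * weighted f u v t) (fun t => -1 * weighted f x y t)).
      * apply (ex_RInt_scal (V := R_NormedModule) (weighted f u v)).
        now apply ex_RInt_weighted.
      * apply (ex_RInt_scal (V := R_NormedModule) (weighted f x y)).
        now apply ex_RInt_weighted.
    + intros t Ht.
      destruct (exp_weight_bounds t (proj1 Ht)) as [Hw0 Hw1].
      pose proof (Hline alpha t Ht). pose proof (Hline beta t Ht).
      replace (1 * _ + _) with (exp (- (lambda * t)) *
        (f (u + alpha * t) (v + beta * t) - f (x + alpha * t) (y + beta * t)))
        by ring.
      rewrite Rabs_mult, (Rabs_pos_eq (exp _)) by lra.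
      rewrite <- (Rmult_1_l (eps / (T + 1))).
      apply Rmult_le_compat; [lra|apply Rabs_pos|lra|].
      left. apply Hd; try (unfold rx, ry; lra).
      * replace (_ - _) with (u - x) by ring. lra.
      * replace (_ - _) with (v - y) by ring. lra.
  - assert (E : (T + 1) * (eps / (T + 1)) = eps) by (field; lra). lra.
Qed.

(** The direction (a, b) is (1, 0) or (0, 1) below, so that one statement serves
    the differentiation under the integral in both variables. *)
Lemma continuity_2d_weighted f (a b x y : R) : smooth f -> forall u t,
  continuity_2d_pt (fun u t =>
    exp (- (lambda * t)) * f (x + a * u + alpha * t) (y + b * u + beta * t)) u t.
Proof.
  intros Hf u t.
  assert (Hlin : forall c d e, continuity_2d_pt (fun u t => c + d * u + e * t) u t).
  { intros c d e.
    repeat apply continuity_2d_pt_plus; repeat apply continuity_2d_pt_mult;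
      auto using continuity_2d_pt_const, continuity_2d_pt_id1,
        continuity_2d_pt_id2. }
  apply continuity_2d_pt_mult.
  - apply (continuity_1d_2d_pt_comp exp (fun _ t => - (lambda * t))).
    + apply derivable_continuous, derivable_exp.
    + apply continuity_2d_pt_opp, continuity_2d_pt_mult;
        auto using continuity_2d_pt_const, continuity_2d_pt_id2.
  - apply (continuity_2d_pt_comp_2 f (fun u t => x + a * u + alpha * t)
      (fun u t => y + b * u + beta * t)); auto using smooth_continuous_2d.
Qed.

Lemma is_derive_char_int_x f : smooth f -> forall x y,
  is_derive (fun z => char_int f z y) x (char_int (dx f) x y).
Proof.
  intros Hf x y. unfold char_int.
  assert (Hw : forall t z, is_derive (fun z => weighted f z y t) z
    (weighted (dx f) z y t)).
  { intros t z. apply (is_derive_scal (fun z => f (z + alpha * t) (y + beta * t))).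
    evar_last.
    - apply (is_derive_comp (fun z => f z (y + beta * t)) (fun z => z + alpha * t)).
      + now apply is_derive_dx.
      + auto_derive; [exact I|reflexivity].
    - cbv [scal]; simpl; cbv [mult]; simpl. ring. }
  rewrite <- (RInt_ext (fun t => Derive (fun z => weighted f z y t) x))
    by (intros t _; apply is_derive_unique, Hw).
  apply (is_derive_RInt_param (fun z t => weighted f z y t)).
  - apply filter_forall. intros z t _. eexists. apply Hw.
  - intros t _.
    apply (continuity_2d_pt_ext (fun z t => exp (- (lambda * t)) *
      dx f (0 + 1 * z + alpha * t) (y + 0 * z + beta * t))).
    + intros z t'. symmetry. replace (0 + 1 * z) with z by ring.
      replace (y + 0 * z) with y by ring. apply is_derive_unique, Hw.
    + now apply continuity_2d_weighted, smooth_dx.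
  - apply filter_forall. intros z. now apply ex_RInt_weighted.
Qed.

Lemma is_derive_char_int_y f : smooth f -> forall x y,
  is_derive (fun z => char_int f x z) y (char_int (dy f) x y).
Proof.
  intros Hf x y. unfold char_int.
  assert (Hw : forall t z, is_derive (fun z => weighted f x z t) z
    (weighted (dy f) x z t)).
  { intros t z. apply (is_derive_scal (fun z => f (x + alpha * t) (z + beta * t))).
    evar_last.
    - apply (is_derive_comp (f (x + alpha * t)) (fun z => z + beta * t)).
      + now apply is_derive_dy.
      + auto_derive; [exact I|reflexivity].
    - cbv [scal]; simpl; cbv [mult]; simpl. ring. }
  rewrite <- (RInt_ext (fun t => Derive (fun z => weighted f x z t) y))
    by (intros t _; apply is_derive_unique, Hw).
  apply (is_derive_RInt_param (fun z t => weighted f x z t)).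
  - apply filter_forall. intros z t _. eexists. apply Hw.
  - intros t _.
    apply (continuity_2d_pt_ext (fun z t => exp (- (lambda * t)) *
      dy f (x + 0 * z + alpha * t) (0 + 1 * z + beta * t))).
    + intros z t'. symmetry. replace (0 + 1 * z) with z by ring.
      replace (x + 0 * z) with x by ring. apply is_derive_unique, Hw.
    + now apply continuity_2d_weighted, smooth_dy.
  - apply filter_forall. intros z. now apply ex_RInt_weighted.
Qed.

(** Partial derivatives commute with the integral, so the integrals of smooth
    fields form a class stable under them. *)
Lemma smooth_char_int f : smooth f -> smooth (char_int f).
Proof.
  intros Hf.
  apply (smooth_of_stable_class (fun g => exists f, smooth f /\ g = char_int f)).
  - intros g [h [Hh ->]]. now apply continuity_2d_char_int.
  - intros g [h [Hh ->]]. exists (char_int (dx h)).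
    split; [eauto using smooth_dx|now apply is_derive_char_int_x].
  - intros g [h [Hh ->]]. exists (char_int (dy h)).
    split; [eauto using smooth_dy|now apply is_derive_char_int_y].
  - eauto.
Qed.

Lemma dx_char_int f : smooth f -> dx (char_int f) = char_int (dx f).
Proof. intros Hf. now apply dx_unique, is_derive_char_int_x. Qed.

Lemma dy_char_int f : smooth f -> dy (char_int f) = char_int (dy f).
Proof. intros Hf. now apply dy_unique, is_derive_char_int_y. Qed.

Lemma char_int_lin a f b g : smooth f -> smooth g ->
  char_int (lin a f b g) = lin a (char_int f) b (char_int g).
Proof.
  intros Hf Hg. apply field_ext. intros x y. unfold char_int, lin.
  rewrite <- RInt_lin by now apply ex_RInt_weighted.
  f_equal. apply functional_extensionality. intros t. ring.
Qed.

Lemma smooth_periodic_char_int xl xr yl yr f :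
  smooth_periodic xl xr yl yr f -> smooth_periodic xl xr yl yr (char_int f).
Proof.
  intros [Sf Pf]. split; [now apply smooth_char_int|].
  intros x y. unfold char_int. split; apply RInt_ext; intros t _.
  - replace (x + (xr - xl) + alpha * t) with (x + alpha * t + (xr - xl)) by ring.
    now rewrite (proj1 (Pf _ _)).
  - replace (y + (yr - yl) + beta * t) with (y + beta * t + (yr - yl)) by ring.
    now rewrite (proj2 (Pf _ _)).
Qed.

Lemma advection_char_int f : smooth f ->
  advection alpha beta (char_int f) = char_int (advection alpha beta f).
Proof.
  intros Hf. unfold advection.
  now rewrite dx_char_int, dy_char_int, char_int_lin
    by auto using smooth_dx, smooth_dy.
Qed.

Lemma helmholtz_char_int mu theta f : smooth f ->
  helmholtz mu theta (char_int f) = char_int (helmholtz mu theta f).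
Proof.
  intros Hf. rewrite !helmholtz_lin.
  rewrite !dx_char_int, !dy_char_int, <- !char_int_lin
    by auto using smooth_dx, smooth_dy, smooth_lin.
  reflexivity.
Qed.

(** The integrand of the left-hand side is the t-derivative of
    - exp (- lambda t) f (x + alpha t, y + beta t). *)
Lemma char_int_resolvent f : smooth f ->
  lin lambda (char_int f) (-1) (advection alpha beta (char_int f)) =
  lin 1 f (- exp (- (lambda * T))) (translate (alpha * T) (beta * T) f).
Proof.
  intros Hf.
  assert (Sr : smooth (lin lambda f (-1) (advection alpha beta f))).
  { unfold advection. auto using smooth_lin, smooth_dx, smooth_dy. }
  rewrite advection_char_int, <- char_int_lin
    by (unfold advection; auto using smooth_lin, smooth_dx, smooth_dy).
  apply field_ext. intros x y.
  unfold char_int at 1.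
  apply is_RInt_unique.
  evar_last.
  - apply (is_RInt_derive (V := R_CompleteNormedModule) (fun t => - weighted f x y t)).
    + intros t _.
      replace (exp _ * _) with (- (- exp (- (lambda * t)) *
        lin lambda f (-1) (advection alpha beta f)
          (x + alpha * t) (y + beta * t))) by ring.
      apply (is_derive_opp (weighted f x y)). now apply is_derive_weighted.
    + intros t _.
      apply (ex_derive_continuous
        (weighted (lin lambda f (-1) (advection alpha beta f)) x y)).
      eexists. now apply is_derive_weighted.
  - cbv [minus plus opp]; simpl. unfold lin, translate.
    replace (x + alpha * 0) with x by ring.
    replace (y + beta * 0) with y by ring.
    rewrite Rmult_0_r, Ropp_0, exp_0. ring.
Qed.

End CharacteristicIntegral.

Lemma smooth_translate a b f : smooth f -> smooth (translate a b f).
Proof.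
  intros Hf.
  apply (smooth_of_stable_class
    (fun g => exists f, smooth f /\ g = translate a b f)).
  - intros g [h [Hh ->]] x y.
    apply (continuity_2d_pt_comp_2 h (fun u _ => u + a) (fun _ v => v + b));
      auto using smooth_continuous_2d, continuity_2d_pt_plus,
        continuity_2d_pt_const, continuity_2d_pt_id1, continuity_2d_pt_id2.
  - intros g [h [Hh ->]]. exists (translate a b (dx h)).
    split; [eauto using smooth_dx|]. intros x y. unfold translate.
    rewrite <- Rmult_1_l.
    apply (is_derive_comp (fun z => h z (y + b)) (fun z => z + a)).
    + now apply is_derive_dx.
    + auto_derive; [exact I|reflexivity].
  - intros g [h [Hh ->]]. exists (translate a b (dy h)).
    split; [eauto using smooth_dy|]. intros x y. unfold translate.
    rewrite <- Rmult_1_l.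
    apply (is_derive_comp (h (x + a)) (fun z => z + b)).
    + now apply is_derive_dy.
    + auto_derive; [exact I|reflexivity].
  - eauto.
Qed.

(** * Skewness of S *)

Section Orthogonality.

Variables xl xr yl yr : R.
Hypotheses (hx : xl < xr) (hy : yl < yr).
Variables alpha beta mu theta : R.
Hypotheses (hmu : 0 <= mu) (htheta : 0 <= theta).
Variables f k : field.
Hypotheses (hf : smooth_periodic xl xr yl yr f)
  (hk : smooth_periodic xl xr yl yr k)
  (hfk : forall x y, helmholtz mu theta k x y = - advection alpha beta f x y).

Local Notation ip := (ip xl xr yl yr).
Local Notation D := (advection alpha beta).
Local Notation H := (helmholtz mu theta).

(** The truncated integrals solve (lambda - D) F = damp f and
    (lambda - D) g = damp k exactly: with F and g the characteristic integrals of f and k,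
    the pairing is lambda^2 <F, g>, and both lambda |F| and |g| are at most the
    norm of the damped f. *)
Lemma ip_damped_bound lambda T : 0 < lambda -> 0 <= T ->
  let damp h := lin 1 h (- exp (- (lambda * T)))
                  (translate (alpha * T) (beta * T) h) in
  Rabs (ip (damp f) (damp k)) <= lambda * ip (damp f) (damp f).
Proof.
  intros Hl HT damp. unfold damp.
  pose proof (Rlt_le _ _ Hl) as Hl'.
  rewrite <- !(char_int_resolvent alpha beta lambda T)
    by (apply hf || apply hk).
  set (F := char_int alpha beta lambda T f).
  set (g := char_int alpha beta lambda T k).
  assert (HF : smooth_periodic xl xr yl yr F)
    by now apply smooth_periodic_char_int.
  assert (Hg : smooth_periodic xl xr yl yr g)
    by now apply smooth_periodic_char_int.
  pose proof (smooth_periodic_advection xl xr yl yr alpha beta F HF) as HDF.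
  pose proof (smooth_periodic_advection xl xr yl yr alpha beta g Hg) as HDg.
  (* H commutes with the characteristic integral, hence H g = - D F. *)
  assert (EH : H g = lin (-1) (D F) 0 F).
  { unfold g, F. rewrite helmholtz_char_int by (assumption || apply hk).
    rewrite advection_char_int by (assumption || apply hf).
    rewrite <- char_int_lin
      by (assumption || apply hf || apply (smooth_periodic_advection xl xr yl yr), hf).
    f_equal. apply field_ext. intros x y. rewrite hfk. unfold lin. ring. }
  pose proof (ip_helmholtz_advection_self xl xr yl yr mu theta alpha beta g Hg)
    as E1.
  pose proof (ip_helmholtz_coercive xl xr yl yr hx hy mu theta g hmu htheta Hg)
    as E2.
  pose proof (ip_advection xl xr yl yr alpha beta F g HF Hg) as E3.
  pose proof (ip_advection_self xl xr yl yr alpha beta F HF) as E4.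
  destruct HF as [SF _], Hg as [Sg _], HDF as [SDF _], HDg as [SDg _].
  rewrite EH, ip_lin_l in E1, E2 by assumption.
  pose proof (ip_young xl xr yl yr hx hy (D F) g SDF Sg) as Y1.
  pose proof (ip_young xl xr yl yr hx hy (lin lambda F 0 F) g
    (smooth_lin _ _ _ _ SF SF) Sg) as Y2.
  rewrite !ip_lin_l, !ip_lin_r in Y2 by auto using smooth_lin.
  rewrite !ip_lin_l, !ip_lin_r by auto using smooth_lin.
  rewrite (ip_comm xl xr yl yr F (D F)), E4.
  pose proof (ip_nonneg xl xr yl yr hx hy F SF) as P1.
  pose proof (ip_nonneg xl xr yl yr hx hy (D F) SDF) as P2.
  apply Rabs_le_between in Y1, Y2.
  (* Only lambda^2 <F, g> survives: E3 cancels the mixed terms and E1 kills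
     <D F, D g>. *)
  match goal with |- Rabs ?e <= _ =>
    replace e with (lambda * (lambda * ip F g)) by nra end.
  rewrite Rabs_mult, (Rabs_pos_eq lambda) by lra.
  apply Rmult_le_compat_l; [lra|].
  apply Rabs_le.
  assert (0 <= lambda * (lambda * ip F F)) by (repeat apply Rmult_le_pos; lra).
  lra.
Qed.

(** Choosing T with exp (- lambda T) = lambda makes the truncation error as small
    as lambda, so that |<f, k>| <= 5 lambda (|f|^2 + |k|^2) for all lambda in
    (0, 1). *)
Lemma ip_flow_orthogonal : ip f k = 0.
Proof.
  destruct (Req_dec (ip f k) 0) as [|Hne]; [assumption|exfalso].
  pose proof (Rabs_pos_lt _ Hne) as Hpos.
  pose proof (proj1 hf) as Sf. pose proof (proj1 hk) as Sk.
  pose proof (ip_nonneg xl xr yl yr hx hy f Sf) as Pf.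
  pose proof (ip_nonneg xl xr yl yr hx hy k Sk) as Pk.
  (* [e] plays the part of both lambda and the truncation factor; its value is
     below 1 and small enough that e * S < |<f, k>|. *)
  set (S := 5 * (ip f f + ip k k)).
  set (e := Rabs (ip f k) / (S + Rabs (ip f k) + 1)).
  assert (Ee : e * (S + Rabs (ip f k) + 1) = Rabs (ip f k))
    by (unfold e; field; unfold S; lra).
  assert (He0 : 0 < e) by (apply Rdiv_lt_0_compat; unfold S; lra).
  assert (He1 : e < 1).
  { apply Rmult_lt_reg_r with (S + Rabs (ip f k) + 1); unfold S in *; lra. }
  set (T := - ln e / e).
  assert (HT : 0 <= T).
  { apply Rdiv_le_0_compat; [|exact He0].
    pose proof (ln_increasing e 1 He0 He1). rewrite ln_1 in *. lra. }
  pose proof (ip_damped_bound e T He0 HT) as B. cbv zeta beta in B.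
  replace (exp (- (e * T))) with e in B.
  2: { replace (- (e * T)) with (ln e) by (unfold T; field; lra).
       now rewrite exp_ln. }
  set (tr := translate (alpha * T) (beta * T)) in B.
  assert (St : forall h, smooth h -> smooth (tr h))
    by (intros; now apply smooth_translate).
  rewrite !ip_lin_l, !ip_lin_r in B by auto using smooth_lin.
  pose proof (ip_young xl xr yl yr hx hy f (tr f) Sf (St f Sf)) as Y1.
  pose proof (ip_young xl xr yl yr hx hy f (tr k) Sf (St k Sk)) as Y2.
  pose proof (ip_young xl xr yl yr hx hy (tr f) k (St f Sf) Sk) as Y3.
  rewrite (ip_comm xl xr yl yr (tr f) f) in B.
  assert (Eff : ip (tr f) (tr f) = ip f f) by now apply ip_translate.
  assert (Ekk : ip (tr k) (tr k) = ip k k) by now apply ip_translate.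
  assert (Efk : ip (tr f) (tr k) = ip f k) by now apply ip_translate.
  rewrite Eff in B, Y1, Y3. rewrite Ekk in Y2. rewrite Efk in B.
  apply Rabs_le_between in Y1, Y2, Y3.
  assert (Hc : Rabs (ip f k) <= e * S).
  { revert B.
    set (c := ip f k) in *. set (p := ip f (tr k)) in *.
    set (r := ip (tr f) k) in *. set (m := ip f (tr f)) in *.
    set (a := ip f f) in *. set (d := ip k k) in *.
    replace (1 * (1 * c + - e * r) + - e * (1 * p + - e * c))
      with ((1 + e * e) * c - e * (p + r)) by ring.
    intros B.
    assert (Hm : 1 * (1 * a + - e * m) + - e * (1 * m + - e * a) <= 4 * a).
    { assert (0 <= e * (m + a)) by (apply Rmult_le_pos; lra).
      assert (0 <= (1 - e) * a) by (apply Rmult_le_pos; lra).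
      assert (0 <= e * ((1 - e) * a)) by (apply Rmult_le_pos; lra).
      lra. }
    assert (He : e * (p + r) <= e * (a + d) /\ - (e * (a + d)) <= e * (p + r)).
    { assert (0 <= e * (a + d - (p + r))) by (apply Rmult_le_pos; lra).
      assert (0 <= e * (a + d + (p + r))) by (apply Rmult_le_pos; lra).
      lra. }
    assert (Hem : e * (1 * (1 * a + - e * m) + - e * (1 * m + - e * a))
      <= e * (4 * a)) by (apply Rmult_le_compat_l; lra).
    apply Rabs_le_between in B. apply Rabs_le.
    assert (0 <= e * d) by (apply Rmult_le_pos; lra).
    assert (0 <= e * e) by (apply Rmult_le_pos; lra).
    unfold S. split; destruct (Rle_or_lt 0 c); nra. }
  unfold S in *. nra.
Qed.

End Orthogonality.
(** * Stage sums and the symplectic condition *)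

Lemma stage_sum_0 f : stage_sum 0 f = 0.
Proof. apply (sum_n_m_zero f). auto. Qed.

Lemma stage_sum_S s f : stage_sum (S s) f = stage_sum s f + f (S s).
Proof. apply (sum_n_Sm f). lia. Qed.

Lemma stage_sum_ext s f g : (forall i, (1 <= i <= s)%nat -> f i = g i) ->
  stage_sum s f = stage_sum s g.
Proof. apply sum_n_m_ext_loc. Qed.

Lemma stage_sum_lin s a b f g :
  stage_sum s (fun i => a * f i + b * g i) = a * stage_sum s f + b * stage_sum s g.
Proof.
  induction s as [|s IH]; [rewrite !stage_sum_0; ring|].
  rewrite !stage_sum_S, IH. ring.
Qed.

Lemma stage_sum_mult_l s a f :
  stage_sum s (fun i => a * f i) = a * stage_sum s f.
Proof. apply (sum_n_m_mult_l (K := R_Ring)). Qed.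

Lemma stage_sum_plus s f g :
  stage_sum s (fun i => f i + g i) = stage_sum s f + stage_sum s g.
Proof. apply (sum_n_m_plus f g). Qed.

Lemma stage_sum_swap s n (f : nat -> nat -> R) :
  stage_sum s (fun i => stage_sum n (fun j => f i j)) =
  stage_sum n (fun j => stage_sum s (fun i => f i j)).
Proof.
  induction s as [|s IH].
  - rewrite stage_sum_0, <- (Rmult_0_l (stage_sum n (fun _ => 0))).
    rewrite <- stage_sum_mult_l. apply stage_sum_ext. intros j _.
    rewrite stage_sum_0. ring.
  - rewrite stage_sum_S, IH, <- stage_sum_plus.
    apply stage_sum_ext. intros j _. now rewrite stage_sum_S.
Qed.

(** The discrete Leibniz rule.  Exchanging the indices in the second double sum on
    the right collects the factor b_i a_ij + b_j a_ji in front of K_i L_j. *)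
Lemma symplectic_sum_product s (A : nat -> nat -> R) (b K L : nat -> R) :
  (forall i j, (1 <= i <= s)%nat -> (1 <= j <= s)%nat ->
     b i * A i j + b j * A j i = b i * b j) ->
  stage_sum s (fun i => b i * K i) * stage_sum s (fun i => b i * L i) =
  stage_sum s (fun i => b i * (K i * stage_sum s (fun j => A i j * L j)
                             + L i * stage_sum s (fun j => A i j * K j))).
Proof.
  intros Hs.
  transitivity (stage_sum s (fun i => stage_sum s (fun j =>
      b i * A i j * (K i * L j))) +
    stage_sum s (fun i => stage_sum s (fun j => b i * A i j * (L i * K j)))).
  - rewrite (stage_sum_swap s s (fun i j => b i * A i j * (L i * K j))).
    rewrite <- stage_sum_plus, Rmult_comm, <- stage_sum_mult_l.
    apply stage_sum_ext. intros i Hi.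
    rewrite <- stage_sum_plus, Rmult_comm, <- stage_sum_mult_l.
    apply stage_sum_ext. intros j Hj.
    replace (_ + _) with ((b i * A i j + b j * A j i) * (K i * L j)) by ring.
    rewrite Hs by assumption. ring.
  - rewrite <- stage_sum_plus. apply stage_sum_ext. intros i _.
    rewrite Rmult_plus_distr_l.
    apply (f_equal2 Rplus); rewrite <- Rmult_assoc, <- stage_sum_mult_l;
      apply stage_sum_ext; intros j _; ring.
Qed.

(** The terms linear in tau are expressed through the stage values U_i, Q_i in place
    of u0, q0; the resulting error of order tau^2 is exactly what the Leibniz
    rule provides. *)
Lemma symplectic_energy_increment s (A : nat -> nat -> R) (b : nat -> R)
    (tau u0 q0 : R) (K L U Q : nat -> R) :
  (forall i j, (1 <= i <= s)%nat -> (1 <= j <= s)%nat ->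
     b i * A i j + b j * A j i = b i * b j) ->
  (forall i, (1 <= i <= s)%nat ->
     U i = u0 + tau * stage_sum s (fun j => A i j * K j)) ->
  (forall i, (1 <= i <= s)%nat ->
     Q i = q0 + tau * stage_sum s (fun j => A i j * L j)) ->
  let u1 := u0 + tau * stage_sum s (fun i => b i * K i) in
  let q1 := q0 + tau * stage_sum s (fun i => b i * L i) in
  1 / 2 * u1 ^ 2 + 1 / 6 * u1 * q1 =
  1 / 2 * u0 ^ 2 + 1 / 6 * u0 * q0 +
  tau * stage_sum s (fun i => b i *
    (K i * U i + 1 / 6 * (K i * Q i + L i * U i))).
Proof.
  intros Hs HU HQ u1 q1.
  pose proof (symplectic_sum_product s A b K K Hs) as EKK.
  pose proof (symplectic_sum_product s A b K L Hs) as EKL.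
  transitivity (1 / 2 * u0 ^ 2 + 1 / 6 * u0 * q0 + tau * (
    (u0 + 1 / 6 * q0) * stage_sum s (fun i => b i * K i) +
    1 / 6 * u0 * stage_sum s (fun i => b i * L i) +
    tau * (1 / 2 * (stage_sum s (fun i => b i * K i) *
                    stage_sum s (fun i => b i * K i)) +
           1 / 6 * (stage_sum s (fun i => b i * K i) *
                    stage_sum s (fun i => b i * L i))))).
  { unfold u1, q1. field. }
  rewrite EKK, EKL, <- !stage_sum_lin, <- stage_sum_mult_l, <- stage_sum_plus.
  do 2 f_equal. apply stage_sum_ext. intros i Hi.
  rewrite HU, HQ by assumption. field.
Qed.

(** * The scheme *)

Lemma smooth_periodic_ext xl xr yl yr f g : (forall x y, f x y = g x y) ->
  smooth_periodic xl xr yl yr g -> smooth_periodic xl xr yl yr f.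
Proof. intros H. now rewrite (field_ext f g H). Qed.

Lemma smooth_periodic_zero xl xr yl yr :
  smooth_periodic xl xr yl yr (fun _ _ => 0).
Proof. split; [apply smooth_const|now split]. Qed.

(** At a fixed time the interpolant is a linear combination of the data, with
    coefficients that depend on the nodes only. *)
Lemma smooth_periodic_L_EP xl xr yl yr c tau u ust l t :
  (forall d, In d l -> smooth_periodic xl xr yl yr (datum_value u ust d)) ->
  smooth_periodic xl xr yl yr (fun x y => L_EP c tau u ust l x y t).
Proof.
  intros Hl. unfold L_EP, lagrange.
  apply (smooth_periodic_ext _ _ _ _ _ (fun x y => fold_right (fun p acc =>
    snd p * lagrange_basis (map (datum_time c tau) l) (fst p) t + acc) 0
    (map (fun d => (datum_time c tau d, datum_value u ust d x y)) l))).
  { intros x y. now rewrite map_map. }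
  generalize (map (datum_time c tau) l) as nodes. intros nodes.
  induction l as [|d l IH]; simpl; [apply smooth_periodic_zero|].
  refine (smooth_periodic_ext _ _ _ _ _ _ _ (smooth_periodic_lin _ _ _ _
    (lagrange_basis nodes (datum_time c tau d) t) _ 1 _
    (Hl d (or_introl eq_refl)) (IH (fun d' h => Hl d' (or_intror h))))).
  intros x y. unfold lin. ring.
Qed.

Lemma smooth_stage_sum s b (h : nat -> field) :
  (forall i, (1 <= i <= s)%nat -> smooth (h i)) ->
  smooth (fun x y => stage_sum s (fun i => b i * h i x y)).
Proof.
  induction s as [|s IH]; intros Hh.
  - rewrite (field_ext _ (fun _ _ => 0)); [apply smooth_const|].
    intros x y. apply stage_sum_0.
  - rewrite (field_ext _ (lin 1 (fun x y => stage_sum s (fun i => b i * h i x y))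
      (b (S s)) (h (S s)))).
    + apply smooth_lin; [apply IH; intros|]; apply Hh; lia.
    + intros x y. rewrite stage_sum_S. unfold lin. ring.
Qed.

Lemma iint_stage_sum xl xr yl yr s b (h : nat -> field) :
  (forall i, (1 <= i <= s)%nat -> smooth (h i)) ->
  iint xl xr yl yr (fun x y => stage_sum s (fun i => b i * h i x y)) =
  stage_sum s (fun i => b i * iint xl xr yl yr (h i)).
Proof.
  induction s as [|s IH]; intros Hh.
  - rewrite stage_sum_0, <- (iint_zero xl xr yl yr). apply iint_ext.
    intros x y. apply stage_sum_0.
  - rewrite stage_sum_S, <- IH by (intros; apply Hh; lia).
    rewrite (iint_ext _ _ _ _ _
      (lin 1 (fun x y => stage_sum s (fun i => b i * h i x y))
      (b (S s)) (h (S s)))).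
    + rewrite iint_lin; [ring| |apply Hh; lia].
      apply smooth_stage_sum. intros. apply Hh. lia.
    + intros x y. rewrite stage_sum_S. unfold lin. ring.
Qed.

(** S is skew: its quadratic form vanishes. *)
Lemma opS_orthogonal xl xr yl yr alpha beta mu theta f k :
  xl < xr -> yl < yr -> 0 <= mu -> 0 <= theta ->
  smooth_periodic xl xr yl yr f ->
  opS xl xr yl yr alpha beta mu theta f k -> ip xl xr yl yr f k = 0.
Proof.
  intros hx hy hmu htheta Hf [w [[Hw Hinv] Hk]].
  assert (Ek : k = lin (-1) w 0 w).
  { apply field_ext. intros x y. rewrite Hk. unfold lin. ring. }
  apply (ip_flow_orthogonal xl xr yl yr hx hy alpha beta mu theta); auto.
  - rewrite Ek. now apply smooth_periodic_lin.
  - intros x y. rewrite Ek, !helmholtz_lin.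
    destruct Hw as [Sw _].
    rewrite !dx_lin, !dy_lin by auto using smooth_dx, smooth_dy.
    specialize (Hinv x y). rewrite helmholtz_lin in Hinv.
    unfold lin, advection in *. unfold lin. lra.
Qed.

Theorem theorem2p4
  (xl xr yl yr : R) (hx : xl < xr) (hy : yl < yr)
  (alpha beta mu theta : R) (hmu : 0 < mu) (htheta : 0 < theta)
  (s : nat) (hs : (1 <= s)%nat)
  (A : nat -> nat -> R) (b c : nat -> R)
  (hc : forall i, (1 <= i <= s)%nat -> c i = stage_sum s (fun j => A i j))
  (hc_distinct : forall i j, (1 <= i <= s)%nat -> (1 <= j <= s)%nat ->
     i <> j -> c i <> c j)
  (hsympl : forall i j, (1 <= i <= s)%nat -> (1 <= j <= s)%nat ->
     b i * A i j + b j * A j i = b i * b j)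
  (tau : R) (htau : 0 < tau)
  (stencil : nat -> list datum)
  (hstencil : forall n, valid_stencil s c tau n (stencil n))
  (u q : nat -> field) (ust qst k l : nat -> nat -> field)
  (hsmooth : forall n,
     smooth_periodic xl xr yl yr (u n) /\ smooth_periodic xl xr yl yr (q n))
  (hsmooth_stages : forall n i, (1 <= i <= s)%nat ->
     smooth_periodic xl xr yl yr (ust n i) /\
     smooth_periodic xl xr yl yr (qst n i) /\
     smooth_periodic xl xr yl yr (k n i) /\
     smooth_periodic xl xr yl yr (l n i))
  (hscheme : forall n,
     scheme_step xl xr yl yr alpha beta mu theta tau s A b c stencil
       u q ust qst k l n) :
  forall n : nat,
    energy xl xr yl yr (u (n + 1)%nat) (q (n + 1)%nat)
    = energy xl xr yl yr (u n) (q n).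
Proof.
  intros n.
  destruct (hscheme n) as (Hk & Hu & Hq & Hl & Hu1 & Hq1).
  set (us := u_star c tau u ust stencil n) in *.
  set (f := fun i x y =>
    ust n i x y + 1 / 6 * qst n i x y + 1 / 3 * us i x y * ust n i x y).
  set (e0 := lin (1 / 2) (mul (u n) (u n)) (1 / 6) (mul (u n) (q n))).
  destruct (hsmooth n) as [[Sun _] [Sqn _]].
  assert (Hus : forall i, (1 <= i <= s)%nat -> smooth_periodic xl xr yl yr (us i)).
  { intros i _. apply smooth_periodic_L_EP. intros d Hd.
    destruct (proj2 (proj2 (hstencil n)) d Hd) as [Hc _].
    destruct d as [m|m j]; simpl in *; [apply hsmooth|].
    now apply hsmooth_stages. }
  assert (Hf : forall i, (1 <= i <= s)%nat -> smooth_periodic xl xr yl yr (f i)).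
  { intros i Hi. destruct (hsmooth_stages n i Hi) as (Si & Qi & _).
    apply (smooth_periodic_ext _ _ _ _ _ (lin 1 (lin 1 (ust n i) (1 / 6) (qst n i))
      (1 / 3) (mul (us i) (ust n i)))).
    - intros x y. unfold f, lin, mul. field.
    - auto using smooth_periodic_lin, smooth_periodic_mul. }
  assert (Hfk : forall i, (1 <= i <= s)%nat -> smooth (mul (f i) (k n i))).
  { intros i Hi. apply smooth_mul; [now apply Hf|].
    now apply (hsmooth_stages n i Hi). }
  transitivity (iint xl xr yl yr (lin 1 e0 tau
    (fun x y => stage_sum s (fun i => b i * mul (f i) (k n i) x y)))).
  - apply (iint_ext _ _ _ _ (fun x y => 1 / 2 * u (n + 1)%nat x y ^ 2
      + 1 / 6 * u (n + 1)%nat x y * q (n + 1)%nat x y)).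
    intros x y. rewrite Hu1, Hq1.
    rewrite (symplectic_energy_increment s A b tau (u n x y) (q n x y)
      (fun i => k n i x y) (fun i => l n i x y)
      (fun i => ust n i x y) (fun i => qst n i x y) hsympl) by auto.
    unfold e0, lin at 1. rewrite Rmult_1_l. f_equal.
    + unfold lin, mul. field.
    + f_equal. apply stage_sum_ext. intros i Hi.
      rewrite (Hl i Hi x y). unfold mul, f. field.
  - rewrite iint_lin.
    2: now apply smooth_lin; apply smooth_mul.
    2: now apply (smooth_stage_sum s b (fun i => mul (f i) (k n i))).
    rewrite (iint_stage_sum _ _ _ _ s b (fun i => mul (f i) (k n i)) Hfk).
    rewrite (stage_sum_ext s _ (fun _ => 0 * 0)).
    + rewrite (stage_sum_mult_l s 0 (fun _ => 0)).
      transitivity (iint xl xr yl yr e0); [ring|].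
      apply (iint_ext _ _ _ _ _ (fun x y => 1 / 2 * u n x y ^ 2
        + 1 / 6 * u n x y * q n x y)).
      intros x y. unfold e0, lin, mul. field.
    + intros i Hi. rewrite Rmult_0_l.
      apply Rmult_eq_0_compat_l.
      apply (opS_orthogonal xl xr yl yr alpha beta mu theta);
        [lra|lra|lra|lra|now apply Hf|exact (Hk i Hi)].
Qed.
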